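(* For every $f\in\mathcal{H}$ there exists a unique $F_f\in\mathcal{A}_1^1$ such that \[ \widetilde{f}(z_s^{\delta}w)=z_s^{\delta}\,(F_f\diamond_s w) \] holds for every $s\in\mu_r$ and every $w\in\mathcal{A}_r$. (Moreover $F_f$ can be taken to be the polynomial defined recursively in the context.)
   Context: Fix an integer $r\ge 1$ and let $\mu_r$ be the set of $r$th roots of unity in $\mathbb{C}$. Let $\mathcal{A}_r=\mathbb{Q}\langle x,y_s\mid s\in\mu_r\rangle$ be the free noncommutative polynomial algebra over $\mathbb{Q}$ on the letters $x$ and $y_s$ ($s\in\mu_r$); words form a basis and $\deg$ is word length. Write $y=y_1$, $z=x+y_1$, $z_s=x+y_s$, $\delta(1)=0$ and $\delta(s)=1$ for $s\neq 1$, $z_s^{\delta}=x+\delta(s)y_s$ (so $z_1^\delta=x$), and $z_{k,s}=x^{k-1}y_s$ ($k\ge1$). Let $\mathcal{A}_1=\mathbb{Q}\langle x,y\rangle\subset\mathcal{A}_r$ and $\mathcal{A}_1^1=\mathbb{Q}\oplus\mathcal{A}_1y$. $R_w$ denotes right multiplication by $w$, and $R_w^{-1}$ denotes removal of a final factor $w$ (applied only to elements of $\mathcal{A}_r w$). Harmonic product: the $\mathbb{Q}$-bilinear product $\ast$ on $\mathcal{A}_r$ with $1\ast w=w\ast 1=w$, $vy_s\ast wy_t=(v\ast wy_t)y_s+(vy_s\ast w)y_t+(v\ast w)xy_{st}$, and $vx\ast w=v\ast wx=(v\ast w)x$ ($v,w\in\mathcal{A}_r$, $s,t\in\mu_r$).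 Let $\varphi$ be the algebra automorphism of $\mathcal{A}_r$ with $\varphi(x)=z$, $\varphi(y_s)=\delta(s)y_s-y_1$. Every word is uniquely $z_{k_1,s_1}\cdots z_{k_l,s_l}x^a$ ($l,a\ge0$); define linear maps $\mathcal{I}(z_{k_1,s_1}\cdots z_{k_l,s_l}x^a)=z_{k_1,s_1}z_{k_2,s_1s_2}\cdots z_{k_l,s_1\cdots s_l}x^a$ and $M_s(z_{k_1,s_1}\cdots z_{k_l,s_l}x^a)=z_{k_1,ss_1}z_{k_2,s_2}\cdots z_{k_l,s_l}x^a$ (with $M_s(x^a)=x^a$), and $\psi_s=\varphi\circ\mathcal{I}\circ M_s$ (a linear bijection). Diamond product: for $s\in\mu_r$, $\diamond_s:\mathcal{A}_1\times\mathcal{A}_r\to\mathcal{A}_r$ is the $\mathbb{Q}$-bilinear map defined recursively on words by $1\diamond_s w=w$, $v\diamond_s1=\psi_s\varphi(v)$, and for $v\in\mathcal{A}_1$, $w\in\mathcal{A}_r$, $1\ne t\in\mu_r$: $vx\diamond_s wx=(v\diamond_s wx)x-(vy\diamond_s w)x$; $vy\diamond_s wx=(v\diamond_s wx)y+(vy\diamond_s w)x$; $vx\diamond_s wy=(v\diamond_s wy)x+(vx\diamond_s w)y$; $vy\diamond_s wy=(v\diamond_s wy)y-(vx\diamond_s w)y$; $vx\diamond_s wy_t=(v\diamond_s wy_t)x+(v\diamond_s wz_t)y_t-(vy\diamond_s w)y_t$; $vy\diamond_s wy_t=(v\diamond_s wy_t)y-(v\diamond_s wz_t)y_t+(vy\diamond_s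 w)y_t$. Rooted trees: $\mathcal{H}$ is the Connes–Kreimer Hopf algebra over $\mathbb{Q}$: the commutative polynomial algebra on (non-planar) rooted trees, with basis the rooted forests and unit the empty forest $\mathbb{I}$; $\bullet$ is the one-vertex tree. $B_+$ is the linear map sending a forest to the tree obtained by attaching all its roots to a new root ($B_+(\mathbb{I})=\bullet$). The coproduct $\Delta$ is the algebra map with $\Delta(\mathbb{I})=\mathbb{I}\otimes\mathbb{I}$ and $\Delta(B_+(f))=B_+(f)\otimes\mathbb{I}+(\mathrm{id}\otimes B_+)\Delta(f)$; the counit kills nonempty forests; $S$ is the antipode. Write $\Delta(f)=\sum_{(f)}f'\otimes f''$. Rooted tree maps: $\widetilde{\mathbb{I}}=\mathrm{id}$, and for each forest $f\ne\mathbb{I}$ the linear map $\widetilde{f}:\mathcal{A}_r\to\mathcal{A}_r$ is determined by $\widetilde f(1)=0$ and: (I) $\widetilde{\bullet}(z_s^\delta)=z_s^\delta(z-z_s^\delta)$, $\widetilde{\bullet}(z)=0$; (II) for a forest $f\ne\mathbb{I}$, $\widetilde{B_+(f)}(z_s^\delta)=R_{z-z_s^\delta}R_{2z-z_s^\delta}R_{z-z_s^\delta}^{-1}\widetilde f(z_s^\delta)$ and $\widetilde{B_+(f)}(z)=0$; (III) if $f=gh$, $\widetilde f(v)=\widetilde g(\widetilde h(v))$ for $v\in\{z,z_s^\delta\mid s\in\mu_r\}$; (IV) $\widetilde f(wv)=\sum_{(f)}\widetilde{f'}(w)\widetilde{f''}(v)$ for $w\in\mathcal{A}_r$, $v\in\{z,z_s^\delta\mid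 s\in\mu_r\}$. These are well defined and $f\mapsto\widetilde f$ extends linearly to an algebra homomorphism $\mathcal{H}\to\mathrm{End}_{\mathbb{Q}}(\mathcal{A}_r)$. The polynomials $F_f$: $F_{\mathbb{I}}=1$, $F_\bullet=y$, $F_{B_+(g)}=R_yR_{x+2y}R_y^{-1}(F_g)$ for forests $g\ne\mathbb{I}$, $F_{gh}=F_g\diamond_1F_h$, extended linearly in $f$. *)

(* Defs.v *)
From HB Require Import structures.
From mathcomp Require Import all_boot all_algebra algC.
From mathcomp Require Import finmap monalg.

Set Implicit Arguments.
Unset Strict Implicit.
Unset Printing Implicit Defensive.
Import GRing.Theory.
Local Open Scope ring_scope.

Definition mu (r : nat) := {s : algC | s ^+ r == 1}.

Section Roots.
Variable r : nat.

Lemma mu1_proof : (1 : algC) ^+ r == 1.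
Proof. by rewrite expr1n. Qed.
Definition mu1 : mu r := exist _ 1 mu1_proof.

Lemma mumul_proof (s t : mu r) : (val s * val t) ^+ r == 1.
Proof. by rewrite exprMn (eqP (valP s)) (eqP (valP t)) mulr1. Qed.
Definition mumul (s t : mu r) : mu r := exist _ (val s * val t) (mumul_proof s t).

Definition delta (s : mu r) : bool := val s != 1.

(* Letters: None = x, Some s = y_s.  Words: sequences of letters.           *)
Definition letter := option (mu r).
Definition A := {malg rat[{fmonom letter}]}.

Definition wd (w : seq letter) : A := << FMonom w >>.
Definition lx : A := wd [:: None].
Definition ly (s : mu r) : A := wd [:: Some s].
Definition y1 : A := ly mu1.
Definition z : A := lx + y1.
Definition zd (s : mu r) : A := lx + (if delta s then ly s else 0).

Definition linext (F : seq letter -> A) (p : A) : A :=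
  \sum_(k <- msupp p) p@_k *: F (fmonom_val k).

(* A_1^1 = Q + A_1 y : every word in the support is empty, or is a word in
   x, y_1 only ending with y_1. *)
Definition inA11 (F : A) : Prop :=
  forall k : {fmonom letter}, F@_k != 0 ->
    (fmonom_val k == [::]) ||
    (all (fun l => l \in [:: None; Some mu1]) (fmonom_val k)
       && (last None (fmonom_val k) == Some mu1)).

(* R_u^{-1}: removal of a final factor u, for u homogeneous of degree 1 with
   nonzero coefficient of y_1 (this is the case for u = z - z_s^delta =
   y_1 - delta(s) y_s and for u = y).  On p = q u it returns q. *)
Definition Rinv (u p : A) : A :=
  \sum_(k <- msupp p)
     match rev (fmonom_val k) with
     | Some t :: rk => if t == mu1 then (p@_k / u@_(FMonom [:: Some mu1])) *: wd (rev rk)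
                      else 0
     | _ => 0
     end.

Definition phiL (l : letter) : A :=
  match l with
  | None => z
  | Some s => (if delta s then ly s else 0) - y1
  end.
Definition phi : A -> A := linext (fun w => \prod_(l <- w) phiL l).

Fixpoint Iw (acc : mu r) (w : seq letter) : seq letter :=
  match w with
  | [::] => [::]
  | None :: w' => None :: Iw acc w'
  | Some s :: w' => Some (mumul acc s) :: Iw (mumul acc s) w'
  end.
Fixpoint Mw (s : mu r) (w : seq letter) : seq letter :=
  match w with
  | [::] => [::]
  | None :: w' => None :: Mw s w'
  | Some t :: w' => Some (mumul s t) :: w'
  end.
Definition Imap : A -> A := linext (fun w => wd (Iw mu1 w)).
Definition Mmap (s : mu r) : A -> A := linext (fun w => wd (Mw s w)).
Definition psi (s : mu r) (p : A) : A := phi (Imap (Mmap s p)).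

(* The diamond product on words.  Words are given REVERSED (head = last
   letter); n is fuel, sufficient when n = (size v + size w).+1.             *)
Fixpoint diaw (s : mu r) (n : nat) (rv rw : seq letter) : A :=
  match n with
  | 0 => 0
  | n'.+1 =>
    let D := diaw s n' in
    match rv, rw with
    | [::], _ => wd (rev rw)
    | _ :: _, [::] => psi s (phi (wd (rev rv)))
    | a :: rv', b :: rw' =>
      match a with
      | None =>
        match b with
        | None => D rv' rw * lx - D (Some mu1 :: rv') rw' * lx
        | Some t =>
          if t == mu1 then D rv' rw * lx + D (None :: rv') rw' * y1
          else D rv' rw * lx + (D rv' (None :: rw') + D rv' (Some t :: rw')) * ly t
               - D (Some mu1 :: rv') rw' * ly t
        end
      | Some u =>
        if u == mu1 then
          match b with
          | None => D rv' rw * y1 + D (Some mu1 :: rv') rw' * lx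
          | Some t =>
            if t == mu1 then D rv' rw * y1 - D (None :: rv') rw' * y1
            else D rv' rw * y1 - (D rv' (None :: rw') + D rv' (Some t :: rw')) * ly t
                 + D (Some mu1 :: rv') rw' * ly t
          end
        else 0 (* first argument not in A_1: unused *)
      end
    end
  end.

Definition dia (s : mu r) (F w : A) : A :=
  \sum_(u <- msupp F) \sum_(v <- msupp w)
     (F@_u * w@_v) *: diaw s (size (fmonom_val u) + size (fmonom_val v)).+1
                            (rev (fmonom_val u)) (rev (fmonom_val v)).

End Roots.

(* Rooted trees.  A (planar representative of a) forest f is encoded by the
   tree B_+(f), i.e. a GenTree node whose children are the trees of f.
   Labels and Leaf constructors carry no information (Leaf = one vertex).   *)
Definition T := GenTree.tree unit.
Definition children (t : T) : seq T :=
  match t with GenTree.Leaf _ => [::] | GenTree.Node _ ts => ts end.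
Definition mkF (ts : seq T) : T := GenTree.Node 0 ts.
Definition fempty : T := mkF [::].
Definition fprod (f g : T) : T := mkF (children f ++ children g).

Fixpoint nv (t : T) : nat :=
  match t with
  | GenTree.Leaf _ => 1
  | GenTree.Node _ ts => (sumn (map nv ts)).+1
  end.

(* Coproduct, as a list of terms c * (f' (x) f'') *)
Definition cpmul (L1 L2 : seq (rat * T * T)) : seq (rat * T * T) :=
  [seq (p.1.1 * q.1.1, fprod p.1.2 q.1.2, fprod p.2 q.2) | p <- L1, q <- L2].

Fixpoint coprod (f : T) : seq (rat * T * T) :=
  match f with
  | GenTree.Leaf _ => [:: (1, fempty, fempty)]
  | GenTree.Node _ ts =>
    foldr (fun t acc =>
             (* Delta(B_+(g)) = B_+(g) (x) I + (id (x) B_+) Delta(g), g = t *)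
             cpmul ((1, mkF [:: t], fempty)
                      :: [seq (p.1.1, p.1.2, mkF [:: p.2]) | p <- coprod t]) acc)
          [:: (1, fempty, fempty)] ts
  end.

(* Canonical representatives of non-planar forests *)
Fixpoint canon (t : T) : T :=
  match t with
  | GenTree.Leaf _ => GenTree.Node 0 [::]
  | GenTree.Node _ ts =>
    GenTree.Node 0 (sort (fun a b : T => leq (choice.pickle a) (choice.pickle b)) (map canon ts))
  end.
Definition forest := {t : T | canon t == t}.

(* The Connes-Kreimer Hopf algebra H (as a vector space with basis the forests) *)
Definition H := {malg rat[forest]}.

Section TreeMaps.
Variable r : nat.
Local Notation A := (A r).

(* values of f~ on generators and letters, given the map for smaller forests *)
Definition genzd (tmP : T -> A -> A) (f : T) (s : mu r) : A :=
  match children f with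
  | [::] => zd s
  | [:: t] =>
    if children t is [::] then zd s * (z r - zd s)
    else Rinv (z r - zd s) (tmP t (zd s)) * (z r *+ 2 - zd s) * (z r - zd s)
  | t :: rest => tmP (mkF [:: t]) (tmP (mkF rest) (zd s))
  end.
Definition genz (f : T) : A := if children f is [::] then z r else 0.
Definition genL (tmP : T -> A -> A) (f : T) (l : letter r) : A :=
  match l with
  | None => genzd tmP f (mu1 r)                               (* x = z_1^delta *)
  | Some s => if s == mu1 r then genz f - genzd tmP f (mu1 r) (* y_1 = z - x *)
              else genzd tmP f s - genzd tmP f (mu1 r)        (* y_s = z_s^delta - x *)
  end.

(* rule (IV), on reversed words *)
Fixpoint tw (tmP : T -> A -> A) (rw : seq (letter r)) (f : T) : A :=
  match rw with
  | [::] => if children f is [::] then 1 else 0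
  | l :: rw' => \sum_(p <- coprod f) p.1.1 *: (tw tmP rw' p.1.2 * genL tmP p.2 l)
  end.

Fixpoint tm (n : nat) : T -> A -> A :=
  match n with
  | 0 => fun _ _ => 0
  | n'.+1 => fun f p => linext (fun w => tw (tm n') (rev w) f) p
  end.

Definition treemap (f : T) : A -> A := tm (nv f).+1 f.

Definition Hmap (f : H) (p : A) : A :=
  \sum_(k <- msupp f) f@_k *: treemap (val k) p.

Fixpoint Ff (f : T) : A :=
  match f with
  | GenTree.Leaf _ => 1
  | GenTree.Node _ ts =>
    (fix go (ts : seq T) : A :=
       match ts with
       | [::] => 1
       | t :: ts' =>
         let Ft := if children t is [::] then y1 r
                   else Rinv (y1 r) (Ff t) * (lx r + y1 r *+ 2) * y1 r in
         if ts' is [::] then Ft else dia (mu1 r) Ft (go ts')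
       end) ts
  end.

Definition FH (f : H) : A := \sum_(k <- msupp f) f@_k *: Ff (val k).

End TreeMaps.

(* Main.v *)
Require Import Defs.
From HB Require Import structures.
From mathcomp Require Import all_boot all_algebra algC.
From mathcomp Require Import finmap monalg.
Import GRing.Theory.
Local Open Scope ring_scope.
Set Implicit Arguments.
Unset Strict Implicit.
Unset Printing Implicit Defensive.

(** Write [zeta_t] for [z_t^delta] and [<>_s] for the diamond product. In the
    generators [z], [zeta_t] of [A_r] and [z], [y] of [A_1] the product obeys
      (v z) <>_s w = v <>_s (w z) = (v <>_s w) z,
      (v y) <>_s (w zeta_t) = (v <>_s (w zeta_t)) (z - zeta_t) + ((v y) <>_s w) zeta_t,
    and [v <>_s 1] is the image of [v] under the algebra morphism [rho_s] sending
    [x] to [zeta_s] and [y] to [z - zeta_s]. It follows by induction that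
    [(v <>_1 w) <>_s u = v <>_s (w <>_s u)], and from this that
      F_f <>_s (u zeta_t p) = sum_(f) (F_f' <>_s u) zeta_t (F_f'' <>_t p)
    by structural induction on the forest [f], without using coassociativity.
    Taking [p = 1] shows that [zeta_s w |-> zeta_s (F_f <>_s w)] satisfies the
    recursion (IV) defining [f~]; an induction on the number of vertices of [f]
    matches the values on [zeta_s]. Uniqueness holds because [F <>_1 1 = F] for
    [F] in [A_1] and left multiplication by [x = zeta_1] is injective. *)

(** * Planar forests and their coproduct *)

(* [PCons us ts] is the planar forest with first tree [B_+(us)] and remaining
   trees [ts]. *)
Inductive pforest := PNil | PCons of pforest & pforest.

Definition pnilp (f : pforest) : bool := if f is PNil then true else false.

Fixpoint psize (f : pforest) : nat :=
  if f is PCons us ts then (psize us + psize ts).+1 else 0.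

Fixpoint pcat (f g : pforest) : pforest :=
  if f is PCons us ts then PCons us (pcat ts g) else g.

Local Notation bplus f := (PCons f PNil).

(** No coefficients are stored: each listed pair has coefficient 1, and multiplicities appear as
    repetitions. For the first tree, the head pair is B_+(us) (x) I and the others come from (id (x)
    B_+) Delta(us). *)
Fixpoint pcop (f : pforest) : seq (pforest * pforest) :=
  match f with
  | PNil => [:: (PNil, PNil)]
  | PCons us ts =>
    [seq (pcat p.1 q.1, pcat p.2 q.2)
       | p <- (bplus us, PNil) :: [seq (p.1, bplus p.2) | p <- pcop us], q <- pcop ts]
  end.

Lemma psize_pcat f g : psize (pcat f g) = (psize f + psize g)%N.
Proof. by elim: f => //= us _ ts ->; rewrite addSn addnA. Qed.

Section SumCoproduct.
Variable V : nmodType.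
Implicit Type Phi : pforest -> pforest -> V.

Lemma sum_pcop_cons us ts Phi :
  \sum_(c <- pcop (PCons us ts)) Phi c.1 c.2 =
  \sum_(q <- pcop ts) Phi (PCons us q.1) q.2 +
  \sum_(p <- pcop us) \sum_(q <- pcop ts) Phi (pcat p.1 q.1) (PCons p.2 q.2).
Proof. by rewrite /= big_cat !big_map big_allpairs_dep /= big_map. Qed.

(** The counit axiom in summed form. Terms that keep the root of the first tree on the right vanish,
    and the induction runs over the remaining trees. *)
Lemma sum_pcop_counitr f (Phi : pforest -> V) :
  \sum_(c <- pcop f) (if pnilp c.2 then Phi c.1 else 0) = Phi f.
Proof.
elim: f Phi => [|us _ ts IH] Phi; first by rewrite big_seq1.
rewrite (sum_pcop_cons us ts (fun a b => if pnilp b then Phi a else 0)) /=.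
rewrite (IH (fun a => Phi (PCons us a))) big1 ?addr0 // => p _.
by rewrite big1.
Qed.

Lemma sum_pcop_counitl f (Phi : pforest -> V) :
  \sum_(c <- pcop f) (if pnilp c.1 then Phi c.2 else 0) = Phi f.
Proof.
elim: f Phi => [|us IHu ts IH] Phi; first by rewrite big_seq1.
rewrite (sum_pcop_cons us ts (fun a b => if pnilp a then Phi b else 0)) /=.
rewrite big1 // add0r -[RHS](IHu (fun a => Phi (PCons a ts))).
apply: eq_bigr => -[[|u1 t1] p2] _ /=; last by rewrite big1.
exact: (IH (fun b => Phi (PCons p2 b))).
Qed.

End SumCoproduct.

Lemma psize_pcop f :
  all (fun c => psize c.1 + psize c.2 <= psize f)%N (pcop f).
Proof.
elim: f => [|us IHu ts IHt] //=.
rewrite all_cat all_map; apply/andP; split.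
  by apply: sub_all IHt => q le /=; rewrite addSn ltnS -addnA leq_add2l.
elim: (pcop us) IHu => //= p ps IH /andP[lep leps].
rewrite all_cat all_map IH // andbT; apply: sub_all IHt => q le /=.
by rewrite !psize_pcat /= addnS ltnS addnACA leq_add.
Qed.

(** Replaces [eq_big_seq] for index types without an [eqType] structure, such as pairs of [pforest];
    with [psize_pcop] it gives the size bounds inside sums over a coproduct. *)
Lemma eq_big_all (V : nmodType) (I : Type) (P : pred I) (cs : seq I) (F G : I -> V) :
  all P cs -> (forall c, P c -> F c = G c) ->
  \sum_(c <- cs) F c = \sum_(c <- cs) G c.
Proof.
move=> Pcs FG; elim: cs Pcs => [|c cs IH] /=; first by rewrite !big_nil.
by move=> /andP[/FG Fc /IH Fcs]; rewrite !big_cons Fc Fcs.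
Qed.

(** * Planar forests inside the [GenTree] encoding *)

Fixpoint em (f : pforest) : seq T :=
  if f is PCons us ts then mkF (em us) :: em ts else [::].

Lemma em_pcat f g : em (pcat f g) = em f ++ em g.
Proof. by elim: f => //= us _ ts ->. Qed.

Lemma nv_em f : nv (mkF (em f)) = (psize f).+1.
Proof.
elim: f => [|us IHu ts IHt] //.
move: IHu IHt => [IHu] [IHt].
by rewrite /= -[psize us]IHu -[psize ts]IHt.
Qed.

Lemma coprod_em f :
  coprod (mkF (em f)) = [seq (1, mkF (em c.1), mkF (em c.2)) | c <- pcop f].
Proof.
elim: f => [|us IHu ts IHt] //.
have -> : coprod (mkF (em (PCons us ts))) =
  cpmul ((1, mkF [:: mkF (em us)], fempty)
     :: [seq (p.1.1, p.1.2, mkF [:: p.2]) | p <- coprod (mkF (em us))])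
    (coprod (mkF (em ts))) by [].
rewrite IHu IHt /cpmul -map_comp.
have -> : (1, mkF [:: mkF (em us)], fempty)
     :: [seq ((fun p : rat * T * T => (p.1.1, p.1.2, mkF [:: p.2])) \o
              (fun c => (1, mkF (em c.1), mkF (em c.2)))) c | c <- pcop us] =
   [seq (1, mkF (em c.1), mkF (em c.2))
      | c <- (bplus us, PNil) :: [seq (p.1, bplus p.2) | p <- pcop us]].
  by rewrite /= -map_comp; congr cons; apply: eq_map.
rewrite allpairs_mapl allpairs_mapr map_allpairs; apply: eq_allpairs => p q.
by rewrite /fprod /= mulr1 !em_pcat.
Qed.

(** Canonical representatives contain neither leaves nor nonzero labels, so every basis forest of
    [H] comes from a [pforest]. *)
Lemma canon_em t : exists f, canon t = mkF (em f).
Proof.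
have em_all ts : (forall t, t \in ts -> exists f, t = mkF (em f)) ->
    exists f, ts = em f.
  elim: ts => [|t' ts IH] H; first by exists PNil.
  have [|fs ->] := IH; first by move=> t'' t''ts; apply: H; rewrite inE t''ts orbT.
  have [f ->] := H t' (mem_head _ _).
  by exists (PCons f fs).
have [n] := ubnP (nv t); elim: n t => // n IH [u|l ts] /=; first by exists PNil.
rewrite ltnS => size_ts.
have [f emf] : exists f, sort (fun a b : T => leq (choice.pickle a) (choice.pickle b))
    (map canon ts) = em f.
  apply: em_all => t'; rewrite mem_sort => /mapP[t'' t''ts ->].
  apply: IH; apply: leq_ltn_trans size_ts.
  elim: ts t''ts => //= a ts IHts; rewrite inE => /orP[/eqP->|/IHts].
    by rewrite leq_addr.
  by move=> le; apply: leq_trans le (leq_addl _ _).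
by exists f; rewrite emf.
Qed.

(** * Diamond products and rooted tree maps in an abstract algebra *)

Section TwoLetterSubalgebra.
Variables (B : lalgType rat) (z y : B).

(** The subalgebra generated by x and y, presented by z = x + y and y because the diamond rules are
    shortest in these generators. *)
Inductive A1 : B -> Prop :=
| A1_one : A1 1
| A1_z p : A1 p -> A1 (p * z)
| A1_y p : A1 p -> A1 (p * y)
| A1_lin c p q : A1 p -> A1 q -> A1 (c *: p + q).

Lemma A1_0 : A1 0.
Proof. by rewrite -[0](addNr 1) -scaleN1r; do !constructor. Qed.

Lemma A1_scale c p : A1 p -> A1 (c *: p).
Proof. by move=> Ap; rewrite -[_ *: _]addr0; apply: A1_lin => //; exact: A1_0. Qed.

Lemma A1_add p q : A1 p -> A1 q -> A1 (p + q).
Proof. by move=> Ap Aq; rewrite -[p]scale1r; apply: A1_lin. Qed.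

Lemma A1_sub p q : A1 p -> A1 q -> A1 (p - q).
Proof. by move=> Ap Aq; rewrite addrC -scaleN1r; apply: A1_lin. Qed.

End TwoLetterSubalgebra.

(* [e], [zd t], [D s] and [FF f] stand for [1] in [mu_r], [zeta_t], [<>_s] and
   [F_f]; [TM f] is [f~], and [gzd f s] the value of [f~] on [zeta_s] prescribed
   by the rules (I)-(III). *)
Section Diamond.
Variables (B : lalgType rat) (J : Type) (e : J) (z y : B) (zd : J -> B).
Variables (D : J -> B -> B -> B) (rho : J -> B -> B).
Local Notation A1 := (A1 z y).
Implicit Types (p q u v w : B) (s t : J).

Hypothesis scaleAr : forall (c : rat) p q, p * (c *: q) = c *: (p * q).
Hypothesis z_sub_zde : z - zd e = y.
Hypothesis gen_ind : forall P : B -> Prop,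
  P 1 -> (forall p, P p -> P (p * z)) -> (forall p t, P p -> P (p * zd t)) ->
  (forall c p q, P p -> P q -> P (c *: p + q)) -> forall p, P p.
Hypothesis DPl : forall s c p q w, D s (c *: p + q) w = c *: D s p w + D s q w.
Hypothesis DPr : forall s v c p q, D s v (c *: p + q) = c *: D s v p + D s v q.
Hypothesis D1w : forall s w, D s 1 w = w.
Hypothesis Dv1 : forall s v, A1 v -> D s v 1 = rho s v.
Hypothesis Dzl : forall s v w, A1 v -> D s (v * z) w = D s v w * z.
Hypothesis Dzr : forall s v w, A1 v -> D s v (w * z) = D s v w * z.
Hypothesis Dyd : forall s v w t, A1 v ->
  D s (v * y) (w * zd t) = D s v (w * zd t) * (z - zd t) + D s (v * y) w * zd t.
Hypothesis rhoP : forall s c p q, rho s (c *: p + q) = c *: rho s p + rho s q.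
Hypothesis rho1 : forall s, rho s 1 = 1.
Hypothesis rhoz : forall s p, rho s (p * z) = rho s p * z.
Hypothesis rhoy : forall s p, rho s (p * y) = rho s p * (z - zd s).

(** * Closure and associativity of the diamond product *)

Lemma DDl s p q w : D s (p + q) w = D s p w + D s q w.
Proof. by rewrite -[p in LHS]scale1r DPl scale1r. Qed.
Lemma DBl s p q w : D s (p - q) w = D s p w - D s q w.
Proof. by rewrite addrC -scaleN1r DPl scaleN1r addrC. Qed.
Lemma DDr s v p q : D s v (p + q) = D s v p + D s v q.
Proof. by rewrite -[p in LHS]scale1r DPr scale1r. Qed.
Lemma DBr s v p q : D s v (p - q) = D s v p - D s v q.
Proof. by rewrite addrC -scaleN1r DPr scaleN1r addrC. Qed.
Lemma D0r s v : D s v 0 = 0.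
Proof. by rewrite -[X in D s v X](subrr 0) DBr subrr. Qed.
Lemma D_sumr s v (I : Type) (cs : seq I) (F : I -> B) :
  D s v (\sum_(c <- cs) F c) = \sum_(c <- cs) D s v (F c).
Proof.
by elim: cs => [|c cs IH]; rewrite ?big_nil ?D0r // !big_cons DDr IH.
Qed.

Lemma rhoB s p q : rho s (p - q) = rho s p - rho s q.
Proof. by rewrite addrC -scaleN1r rhoP scaleN1r addrC. Qed.

Lemma rhoD s p q : rho s (p + q) = rho s p + rho s q.
Proof. by rewrite -[p in LHS]scale1r rhoP scale1r. Qed.

Lemma zde : zd e = z - y.
Proof. by rewrite -z_sub_zde opprB addrC subrK. Qed.

Lemma A1_zde p : A1 p -> A1 (p * zd e).
Proof. by move=> Ap; rewrite zde mulrBr; apply: A1_sub; constructor. Qed.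

Lemma rho_id v : A1 v -> rho e v = v.
Proof.
elim=> [|p _ IH|p _ IH|c p q _ IHp _ IHq]; first exact: rho1.
- by rewrite rhoz IH.
- by rewrite rhoy z_sub_zde IH.
- by rewrite rhoP IHp IHq.
Qed.

Lemma rhozde s p : rho s (p * zd e) = rho s p * zd s.
Proof. by rewrite zde mulrBr rhoB rhoz rhoy mulrBr opprB addrC subrK. Qed.

(** Substituting y = z - zeta_1 in the second argument exhibits a final factor y; this is why
    products of polynomials ending in y end in y. *)
Lemma Dyy s v w : A1 v ->
  D s (v * y) (w * y) = (D s (v * y) w - D s v (w * zd e)) * y.
Proof.
move=> Av; rewrite -[in w * y]z_sub_zde mulrBr DBr Dzr ?Dyd //; last by constructor.
rewrite z_sub_zde mulrBl [D s v _ * _ + _]addrC opprD addrA -mulrBr.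
by rewrite z_sub_zde.
Qed.

Lemma Dxd s v w t : A1 v ->
  D s (v * zd e) (w * zd t) = (D s v (w * zd t) - D s (v * y) w) * zd t.
Proof.
move=> Av; rewrite zde mulrBr DBl Dzl // Dyd // opprD addrA -mulrBr.
by rewrite opprB [z + _]addrC subrK -mulrBl.
Qed.

Lemma A1_D v w : A1 v -> A1 w -> A1 (D e v w).
Proof.
move=> Av; elim: Av w => [|{}v Av IHv|{}v Av IHv|c p q Ap IHp Aq IHq] w Aw.
- by rewrite D1w.
- by rewrite Dzl //; constructor; apply: IHv.
- elim: Aw => [|{}w Aw IHw|{}w Aw IHw|c p q Ap IHp Aq IHq].
  + by rewrite Dv1 ?rho_id //; constructor.
  + by rewrite Dzr //; constructor.
  + rewrite Dyy //; constructor; apply: A1_sub => //.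
    by apply: IHv; apply: A1_zde.
  + by rewrite DPr; apply: A1_lin.
- by rewrite DPl; apply: A1_lin; auto.
Qed.

(** The case u = 1 of associativity, since rho_s(w) is w <>_s 1. *)
Lemma rho_D s v w : A1 v -> A1 w -> rho s (D e v w) = D s v (rho s w).
Proof.
move=> Av; elim: Av w => [|{}v Av IHv|{}v Av IHv|c p q Ap IHp Aq IHq] w Aw.
- by rewrite !D1w.
- by rewrite !Dzl // rhoz IHv.
- elim: Aw => [|{}w Aw IHw|{}w Aw IHw|c p q Ap IHp Aq IHq].
  + by rewrite rho1 !Dv1 ?rho_id //; constructor.
  + by rewrite rhoz !Dzr ?rhoz ?IHw //; constructor.
  + rewrite Dyy // !rhoy rhoB IHw IHv; last exact: A1_zde.
    rewrite [RHS](_ : _ = D s (v * y) (rho s w * z) - D s (v * y) (rho s w * zd s));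
      last by rewrite -DBr -mulrBr.
    rewrite Dzr ?Dyd //; last by constructor.
    by rewrite rhozde mulrBl [X in _ = _ - X]addrC opprD addrA -mulrBr.
  + by rewrite rhoP !DPr rhoP IHp IHq.
- by rewrite !DPl rhoP IHp ?IHq.
Qed.

(* The only case that is not immediate is [v y], [w y], [u zeta_t]; it reduces to
   triples that are smaller in the lexicographic order of [v], [w], [u]. *)
Lemma D_assoc s v w u : A1 v -> A1 w -> D s (D e v w) u = D s v (D s w u).
Proof.
move=> Av; elim: Av w u => [|{}v Av IHv|{}v Av IHv|c p q Ap IHp Aq IHq] w u Aw.
- by rewrite !D1w.
- by rewrite !Dzl ?IHv //; apply: A1_D.
- have Avy : A1 (v * y) by constructor.
  elim: Aw u => [|{}w Aw IHw|{}w Aw IHw|c p q Ap IHp Aq IHq] u.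
  + by rewrite D1w Dv1 // rho_id.
  + by rewrite Dzr ?Dzl ?Dzr ?IHw //; apply: A1_D.
  + have Awy : A1 (w * y) by constructor.
    (* By [Dyy], (v y) <>_1 (w y) = E y for this E; [Dyd] applies to E y once E lies in [A1]. *)
    have AE : A1 (D e (v * y) w - D e v (w * zd e)).
      by apply: A1_sub; apply: A1_D => //; apply: A1_zde.
    elim/gen_ind: u => [|u IHu|u t IHu|c p q IHp IHq].
    * by rewrite [in RHS]Dv1 // Dv1 ?rho_D //; apply: A1_D.
    * by rewrite !Dzr ?IHu //; apply: A1_D.
    * set a := D s w (u * zd t); set b := D s (w * y) u.
      (* The left side is opened as E y, expanded by [Dyd], and its last term folded back so that
         the induction on u applies; the two parts of E fall under the inductions on w and on v. *)
      rewrite {1}Dyy // Dyd // -Dyy // IHu DBl IHw IHv; last exact: A1_zde.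
      rewrite Dxd // -/a -/b [in RHS]Dyd // -/a -/b.
      rewrite [(a - b) * _]mulrBl DBr [in RHS]DDr [a * _]mulrBr [in RHS]DBr Dzr // !Dyd //.
      rewrite [in RHS]addrA; congr (_ + _).
      rewrite [X in _ = _ - X + _]addrC [in RHS]opprD [in RHS]addrA -mulrBr -mulrBl -mulrDl.
      by rewrite opprB addrA addrAC.
    * by rewrite !DPr IHp IHq.
  + by rewrite DPr !DPl DPr IHp IHq.
- by rewrite !DPl IHp ?IHq.
Qed.


(** * The polynomials F_f and their compatibility with the coproduct *)

Variables (Rinv : J -> B -> B) (FF : pforest -> B).
Hypothesis RinvP : forall t c p q, Rinv t (c *: p + q) = c *: Rinv t p + Rinv t q.
Hypothesis RinvK : forall t p, Rinv t (p * (z - zd t)) = p.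
Hypothesis FF_nil : FF PNil = 1.
Hypothesis FF_dot : FF (bplus PNil) = y.
Hypothesis FF_bplus : forall us G, ~~ pnilp us -> FF us = G * y ->
  FF (bplus us) = G * (zd e + y *+ 2) * y.
Hypothesis FF_cons : forall us ts, ~~ pnilp ts ->
  FF (PCons us ts) = D e (FF (bplus us)) (FF ts).

(** Gives R_y^{-1}(F_f) a meaning: B_+ leaves a final y by its formula, and [Dyy] keeps one under
    products. *)
Lemma FF_mul_y f : ~~ pnilp f -> exists2 G, A1 G & FF f = G * y.
Proof.
elim: f => // us IHu ts IHt _.
have [G AG EG] : exists2 G, A1 G & FF (bplus us) = G * y.
  have [usN|nus] := boolP (pnilp us).
    case: us usN {IHu} => // _; exists 1; first by constructor.
    by rewrite FF_dot mul1r.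
  have [G AG EG] := IHu nus; exists (G * (zd e + y *+ 2)); last exact: FF_bplus.
  by rewrite zde mulr2n addrA subrK mulrDr; apply: A1_add; constructor.
have [tsN|nts] := boolP (pnilp ts); first by case: ts tsN {IHt} => // _; exists G.
have [K AK EK] := IHt nts; rewrite FF_cons // EG EK Dyy //.
exists (D e (G * y) K - D e G (K * zd e)) => //.
by apply: A1_sub; apply: A1_D => //; [constructor|apply: A1_zde].
Qed.

Lemma A1_FF f : A1 (FF f).
Proof.
have [fN|/FF_mul_y[G AG ->]] := boolP (pnilp f); last by constructor.
by case: f fN => // _; rewrite FF_nil; constructor.
Qed.
Hint Resolve A1_FF : core.

(** Extends the product rule to empty [ts], where F = 1 is right neutral for <>_1 on [A1] because
    rho_1 is the identity there. *)
Lemma FF_consE us ts : FF (PCons us ts) = D e (FF (bplus us)) (FF ts).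
Proof.
have [tsN|] := boolP (pnilp ts); last exact: FF_cons.
by case: ts tsN => // _; rewrite FF_nil Dv1 // rho_id.
Qed.

Lemma FF_pcat f g : FF (pcat f g) = D e (FF f) (FF g).
Proof.
elim: f => [|us _ ts IH] /=; first by rewrite FF_nil D1w.
by rewrite FF_consE IH [in RHS]FF_consE D_assoc.
Qed.

(** The operator R_{z-zeta_t} R_{2z-zeta_t} R_{z-zeta_t}^{-1} of rule (II). *)
Definition Top t m := Rinv t m * (z *+ 2 - zd t) * (z - zd t).

Lemma TopP t c p q : Top t (c *: p + q) = c *: Top t p + Top t q.
Proof. by rewrite /Top RinvP !mulrDl -!scalerAl. Qed.

Lemma TopD t p q : Top t (p + q) = Top t p + Top t q.
Proof. by rewrite -[p in LHS]scale1r TopP scale1r. Qed.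

Lemma Top0 t : Top t 0 = 0.
Proof. by have := RinvK t 0; rewrite mul0r /Top => ->; rewrite !mul0r. Qed.

Lemma TopK t p : Top t (p * (z - zd t)) = p * (z *+ 2 - zd t) * (z - zd t).
Proof. by rewrite /Top RinvK. Qed.

(** Divisibility of m by z - zeta_t is assumed because [RinvK] computes [Rinv] only on such
    multiples. *)
Lemma Top_mull t q m n : m = n * (z - zd t) -> Top t (q * m) = q * Top t m.
Proof. by move=> ->; rewrite mulrA !TopK !mulrA. Qed.

Lemma Top_sum t (I : Type) (cs : seq I) (F : I -> B) :
  Top t (\sum_(c <- cs) F c) = \sum_(c <- cs) Top t (F c).
Proof. by elim: cs => [|c cs IH]; rewrite ?big_nil ?Top0 // !big_cons TopD IH. Qed.

(** Provides the divisibility required by [Top_mull]: for F_b = G y the difference is the first term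
    of [Dyd]. *)
Lemma D_FF_sub_div b s t p : exists n,
  D s (FF b) (p * zd t) - D s (FF b) p * zd t = n * (z - zd t).
Proof.
have [bN|/FF_mul_y[G AG ->]] := boolP (pnilp b).
  by case: b bN => // _; exists 0; rewrite FF_nil !D1w subrr mul0r.
by exists (D s G (p * zd t)); rewrite Dyd // addrK.
Qed.

Lemma rho_FF_sub_div b t : exists n,
  zd t * rho t (FF b) - (if pnilp b then zd t else 0) = n * (z - zd t).
Proof.
have [bN|/FF_mul_y[G AG ->]] := boolP (pnilp b).
  by case: b bN => // _; exists 0; rewrite FF_nil rho1 mulr1 subrr mul0r.
by exists (zd t * rho t G); rewrite rhoy subr0 mulrA.
Qed.

Lemma FF_bplusE us G : ~~ pnilp us -> FF us = G * y ->
  FF (bplus us) = (G * z + G * y) * y.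
Proof.
move=> nus /(FF_bplus nus) ->; rewrite zde mulr2n addrA subrK.
by rewrite -mulrDr.
Qed.

(* With [F_b = G y] both sides expand to terms in [G <>_s (p zeta_t)] and
   [F_b <>_s p]; in this form the identity also covers [b = PNil], so that it can
   be summed over a coproduct. *)
Lemma D_FF_bplus b s t p :
  D s (FF (bplus b)) (p * zd t) =
  Top t (D s (FF b) (p * zd t) - D s (FF b) p * zd t)
  + D s (FF b) p * zd t * (z - zd t) + D s (FF (bplus b)) p * zd t.
Proof.
have [bN|nb] := boolP (pnilp b).
  case: b bN => // _; rewrite FF_dot FF_nil !D1w subrr Top0 add0r.
  by rewrite -[y]mul1r Dyd ?D1w //; constructor.
have [G AG EG] := FF_mul_y nb; rewrite (FF_bplusE nb EG).
have AGzy : A1 (G * z + G * y) by apply: A1_add; constructor.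
rewrite Dyd //; congr (_ + _); rewrite EG Dyd // addrK TopK DDl Dzl // Dyd //.
by rewrite -mulrDl addrA -mulrDr mulr2n addrA.
Qed.

(** The elements zeta_t rho_t(F_f) obey the recursion prescribed for f~ on zeta_t; the conditional
    terms merge rule (I), where b is empty, with rule (II). *)
Lemma rho_FF_bplus b t :
  zd t * rho t (FF (bplus b)) =
  Top t (zd t * rho t (FF b) - (if pnilp b then zd t else 0))
  + (if pnilp b then zd t * (z - zd t) else 0).
Proof.
have [bN|nb] := boolP (pnilp b).
  case: b bN => // _; rewrite FF_dot FF_nil rho1 mulr1 subrr Top0 add0r.
  by rewrite -[y]mul1r rhoy rho1 mul1r.
have [G AG EG] := FF_mul_y nb; rewrite (FF_bplusE nb EG) EG subr0 addr0.
rewrite !rhoy rhoD rhoz rhoy !mulrA TopK -mulrDr !mulrA; congr (_ * _ * _).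
by rewrite mulr2n addrA.
Qed.

(** Mirrors Delta(B_+(f)) = B_+(f) (x) I + (id (x) B_+) Delta(f): by induction on p, the coproduct
    formula passes from [us] to B_+(us). *)
Lemma D_FF_coprod_bplus us :
  (forall s t u p, D s (FF us) (u * zd t * p) =
     \sum_(c <- pcop us) D s (FF c.1) u * zd t * D t (FF c.2) p) ->
  forall s t u p, D s (FF (bplus us)) (u * zd t * p) =
    D s (FF (bplus us)) u * zd t * p
    + \sum_(c <- pcop us) D s (FF c.1) u * zd t * D t (FF (bplus c.2)) p.
Proof.
move=> IH s t u; elim/gen_ind => [|p IHp|p x IHp|c p q IHp IHq].
- rewrite !mulr1 D_FF_bplus [RHS]addrC; congr (_ + _).
  (* The counit writes this term as a sum over the same coproduct, so that the argument of [Top]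
     becomes a termwise difference divisible by z - zeta_t. *)
  have -> : D s (FF us) u * zd t =
      \sum_(c <- pcop us) (if pnilp c.2 then D s (FF c.1) u * zd t else 0).
    by rewrite (sum_pcop_counitr us (fun a => D s (FF a) u * zd t)).
  have := IH s t u 1; rewrite mulr1 => ->.
  rewrite -sumrB Top_sum mulr_suml -big_split; apply: eq_bigr => c _ /=.
  rewrite !Dv1 // -[in RHS]mulrA rho_FF_bplus [in RHS]mulrDr; congr (_ + _).
    have [n En] := rho_FF_sub_div c.2 t.
    rewrite -(Top_mull _ En) mulrBr mulrA.
    by case: ifP => _ //; rewrite mulr0.
  by case: ifP => _; rewrite ?mulr0 ?mul0r // mulrA.
- rewrite !mulrA !Dzr // IHp mulrDl; congr (_ + _); rewrite mulr_suml.
  by apply: eq_bigr => c _; rewrite Dzr // mulrA.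
(* Here [D_FF_bplus] strips the last letter zeta_x, and the formula for [us] expands the three
   resulting terms in F_us. *)
- rewrite mulrA D_FF_bplus -mulrA !IH IHp mulrDl mulrA.
  rewrite addrCA; congr (_ + _).
  rewrite !mulr_suml -sumrB Top_sum -!big_split; apply: eq_bigr => c _ /=.
  rewrite D_FF_bplus !mulrDr !mulrA; congr (_ + _ + _).
  have [n En] := D_FF_sub_div c.2 t x p.
  by have := Top_mull (D s (FF c.1) u * zd t) En; rewrite mulrBr !mulrA => ->.
- rewrite mulrDr scaleAr DPr IHp IHq mulrDr scaleAr scalerDr addrACA.
  rewrite scaler_sumr -big_split; congr (_ + _); apply: eq_bigr => i _ /=.
  by rewrite DPr mulrDr scaleAr.
Qed.

(** Associativity turns the action of F of a product into two successive actions, expanded one after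
    the other; [sum_pcop_cons] matches the resulting double sum. *)
Lemma D_FF_coprod f s t u p :
  D s (FF f) (u * zd t * p) =
  \sum_(c <- pcop f) D s (FF c.1) u * zd t * D t (FF c.2) p.
Proof.
elim: f s t u p => [|us IHu ts IHt] s t u p; first by rewrite big_seq1 !FF_nil !D1w.
rewrite (sum_pcop_cons us ts (fun a b => D s (FF a) u * zd t * D t (FF b) p)).
rewrite FF_consE D_assoc // IHt D_sumr exchange_big -big_split.
apply: eq_bigr => c _ /=; rewrite (D_FF_coprod_bplus IHu); congr (_ + _).
  by rewrite (FF_consE us c.1) D_assoc.
by apply: eq_bigr => c' _; rewrite FF_pcat [in RHS]FF_consE !D_assoc.
Qed.

(** * Comparison with the rooted tree maps *)

Variables (TM : pforest -> B -> B) (gzd : pforest -> J -> B).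
Hypothesis TMP : forall f c p q, TM f (c *: p + q) = c *: TM f p + TM f q.
Hypothesis TM1 : forall f, TM f 1 = if pnilp f then 1 else 0.
Hypothesis TMz : forall f p, TM f (p * z) = TM f p * z.
Hypothesis TMzd : forall f p t,
  TM f (p * zd t) = \sum_(c <- pcop f) TM c.1 p * gzd c.2 t.
Hypothesis gzd_nil : forall s, gzd PNil s = zd s.
Hypothesis gzd_dot : forall s, gzd (bplus PNil) s = zd s * (z - zd s).
Hypothesis gzd_bplus : forall us s, ~~ pnilp us ->
  gzd (bplus us) s = Top s (TM us (zd s)).
Hypothesis gzd_cons : forall us ts s, ~~ pnilp ts ->
  gzd (PCons us ts) s = TM (bplus us) (TM ts (zd s)).

Lemma TM_zd f s : TM f (zd s) = gzd f s.
Proof.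
rewrite -[zd s]mul1r TMzd -[RHS](sum_pcop_counitl f (gzd^~ s)).
by apply: eq_bigr => c _; rewrite TM1; case: ifP; rewrite ?mul1r ?mul0r.
Qed.

(** Separates the two inductions: correct values on all zeta_s up to size n give the formula up to
    size n, by induction on w and rule (IV). *)
Lemma TM_FF_of_gzd n :
  (forall f s, (psize f <= n)%N -> gzd f s = zd s * rho s (FF f)) ->
  forall w f s, (psize f <= n)%N -> TM f (zd s * w) = zd s * D s (FF f) w.
Proof.
move=> Hg; elim/gen_ind => [|w IH|w t IH|c p q IHp IHq] f s fn.
- by rewrite mulr1 TM_zd Dv1 // Hg.
- by rewrite mulrA TMz IH // Dzr // mulrA.
- have := D_FF_coprod f s t w 1; rewrite mulr1 => ->.
  rewrite mulrA TMzd mulr_sumr.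
  apply: eq_big_all (psize_pcop f) _ => c le.
  rewrite IH; last by apply: leq_trans fn; apply: leq_trans le; apply: leq_addr.
  rewrite Hg; last by apply: leq_trans fn; apply: leq_trans le; apply: leq_addl.
  by rewrite Dv1 // !mulrA.
- by rewrite mulrDr scaleAr TMP IHp // IHq // DPr mulrDr scaleAr.
Qed.

(** Induction on size. For several trees, rule (III) composes two maps of smaller forests, both
    known by [TM_FF_of_gzd], and associativity recombines them into F_f. *)
Lemma gzd_FF n f s : (psize f <= n)%N -> gzd f s = zd s * rho s (FF f).
Proof.
elim: n f s => [|n IH] [|us ts] s //; rewrite ?gzd_nil ?FF_nil ?rho1 ?mulr1 //=.
rewrite ltnS => le_n.
have le_us : (psize us <= n)%N by apply: leq_trans le_n; apply: leq_addr.
have [tsN|nts] := boolP (pnilp ts).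
  case: ts tsN le_n => // _ _; rewrite rho_FF_bplus.
  have [usN|nus] := boolP (pnilp us).
    by case: us usN le_us => // _ _; rewrite gzd_dot FF_nil rho1 mulr1 subrr Top0 add0r.
  by rewrite gzd_bplus // TM_zd IH // subr0 addr0.
have TMn := TM_FF_of_gzd IH.
have le_ts : (psize ts <= n)%N by apply: leq_trans le_n; apply: leq_addl.
(* The root of the first tree is paid for by a vertex of the nonempty [ts]. *)
have le_b : (psize (bplus us) <= n)%N.
  rewrite /= addn0; apply: leq_trans le_n.
  by case: ts nts {le_ts} => //= u1 t1 _; rewrite addnS ltnS leq_addr.
rewrite gzd_cons // -[zd s]mulr1 TMn // TMn // mulr1 -D_assoc // -FF_consE.
by rewrite Dv1.
Qed.

Theorem TM_FF f s w : TM f (zd s * w) = zd s * D s (FF f) w.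
Proof. by apply: (@TM_FF_of_gzd (psize f)) => // g t; apply: gzd_FF. Qed.

End Diamond.

(** * Algebras with a basis of words *)

Lemma delta_neq_mu1 (r : nat) (s : mu r) : delta s = (s != mu1 r).
Proof. by rewrite /delta -val_eqE. Qed.

Definition wdA1 (r : nat) (w : seq (letter r)) :=
  all (fun l => l \in [:: None; Some (mu1 r)]) w.

Lemma wdA1_x (r : nat) (w : seq (letter r)) : wdA1 w -> wdA1 (None :: w).
Proof. by move=> Aw; apply/andP. Qed.

Lemma wdA1_y (r : nat) (w : seq (letter r)) : wdA1 w -> wdA1 (Some (mu1 r) :: w).
Proof. by move=> Aw; apply/andP; split; rewrite // !inE eqxx orbT. Qed.

Definition ysub (r : nat) (s : mu r) (l : letter r) : letter r :=
  if l is Some _ then Some s else None.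

(** M_s puts s on the first y, and every later partial product is again s, so all letters y_1 become
    y_s. *)
Lemma Iw_Mw_A1 (r : nat) (s : mu r) (w : seq (letter r)) :
  wdA1 w -> Iw (mu1 r) (Mw s w) = map (ysub s) w.
Proof.
have m1 (t : mu r) : mumul t (mu1 r) = t by apply: val_inj; rewrite /= mulr1.
have m1' (t : mu r) : mumul (mu1 r) t = t by apply: val_inj; rewrite /= mul1r.
have I1 (v : seq (letter r)) : wdA1 v -> Iw s v = map (ysub s) v.
  elim: v => //= [[t|]] v IH /= => [/andP[t1 /IH Iv]|/IH ->] //.
  have -> : t = mu1 r by move: t1; rewrite !inE => /orP[|/eqP[]].
  by rewrite m1 Iv.
elim: w => //= [[t|]] w IH /= => [/andP[t1 /I1 Iv]|/IH ->] //.
have -> : t = mu1 r by move: t1; rewrite !inE => /orP[|/eqP[]].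
by rewrite m1 m1' Iv.
Qed.

Section Words.
Variables (r : nat) (B : lalgType rat).
Local Notation letter := (letter r).
Local Notation m1 := (mu1 r).
Variables (wd : seq letter -> B) (linext : (seq letter -> B) -> B -> B).
Variables (z : B) (zd : mu r -> B).
Implicit Types (p q : B) (v w : seq letter) (s t : mu r).

Hypothesis scaleAr : forall (c : rat) p q, p * (c *: q) = c *: (p * q).
Hypothesis linextP : forall F c p q,
  linext F (c *: p + q) = c *: linext F p + linext F q.
Hypothesis linext_wd : forall F w, linext F (wd w) = F w.
Hypothesis wd_nil : wd [::] = 1.
Hypothesis wd_cat : forall v w, wd (v ++ w) = wd v * wd w.
Hypothesis wd_ind : forall P : B -> Prop, (forall w, P (wd w)) ->
  (forall c p q, P p -> P q -> P (c *: p + q)) -> forall p, P p.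

Local Notation X := (wd [:: None]).
Local Notation Y s := (wd [:: Some s]).
Local Notation y := (Y m1).
Hypothesis zE : z = X + y.
Hypothesis zdE : forall s, zd s = X + (if delta s then Y s else 0).
Local Notation A1 := (A1 z y).

Lemma linextD F p q : linext F (p + q) = linext F p + linext F q.
Proof. by rewrite -[p in LHS]scale1r linextP scale1r. Qed.

Lemma linextB F p q : linext F (p - q) = linext F p - linext F q.
Proof. by rewrite -scaleN1r addrC linextP scaleN1r addrC. Qed.

Lemma linext0 F : linext F 0 = 0.
Proof. by rewrite -[X in linext F X](subrr 0) linextB subrr. Qed.

Lemma wd_cons l w : wd (l :: w) = wd [:: l] * wd w.
Proof. exact: (wd_cat [:: l]). Qed.

Lemma wd_rcons w l : wd (rcons w l) = wd w * wd [:: l].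
Proof. by rewrite -cats1 wd_cat. Qed.

Lemma zd_mu1 : zd m1 = X.
Proof. by rewrite zdE delta_neq_mu1 eqxx addr0. Qed.

Lemma zd_neq_mu1 s : s != m1 -> zd s = X + Y s.
Proof. by rewrite zdE delta_neq_mu1 => ->. Qed.

Lemma subz_zd s : z - zd s = y - (if delta s then Y s else 0).
Proof. by rewrite zE zdE opprD addrACA subrr add0r. Qed.

Lemma subz_mu1 : z - zd m1 = y.
Proof. by rewrite zd_mu1 zE addrC addKr. Qed.

(** The letters are recovered from the new generators by x = zeta_1, y_1 = z - zeta_1 and y_s =
    zeta_s - zeta_1 for s other than 1. *)
Lemma gen_ind (P : B -> Prop) :
  P 1 -> (forall p, P p -> P (p * z)) -> (forall p t, P p -> P (p * zd t)) ->
  (forall c p q, P p -> P q -> P (c *: p + q)) -> forall p, P p.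
Proof.
move=> P1 Pz Pd Plin; apply: wd_ind => // w.
have Pb p q : P p -> P q -> P (p - q).
  by move=> Pp Pq; rewrite addrC -scaleN1r; apply: Plin.
elim/last_ind: w => [|w l IH]; first by rewrite wd_nil.
rewrite wd_rcons; case: l => [s|]; last by rewrite -zd_mu1; apply: Pd.
have [->|ns] := eqVneq s m1; first by rewrite -subz_mu1 mulrBr; apply: Pb; auto.
have -> : Y s = zd s - zd m1 by rewrite zd_neq_mu1 // zd_mu1 addrC addKr.
by rewrite mulrBr; apply: Pb; auto.
Qed.

Lemma A1_wd w : wdA1 w -> A1 (wd w).
Proof.
rewrite /wdA1; elim/last_ind: w => [|w l IH]; first by rewrite wd_nil; constructor.
rewrite all_rcons wd_rcons !inE => /andP[/orP[/eqP->|/eqP->]] /IH Aw; last by constructor.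
have -> : X = z - y by rewrite zE addrK.
by rewrite mulrBr; apply: A1_sub; constructor.
Qed.

Lemma A1_wd_ind (P : B -> Prop) :
  (forall w, wdA1 w -> P (wd w)) ->
  (forall c p q, P p -> P q -> P (c *: p + q)) -> forall p, A1 p -> P p.
Proof.
(* The claim is strengthened by a trailing word v, which absorbs the last factors of p one at a
   time. *)
move=> Pw Plin p Ap; have: forall v, wdA1 v -> P (p * wd v).
  elim: Ap => [|{}p Ap IH|{}p Ap IH|c {}p q Ap IHp Aq IHq] v Av.
  - by rewrite mul1r; apply: Pw.
  - have -> : p * z * wd v = 1 *: (p * wd (None :: v)) + p * wd (Some m1 :: v).
      by rewrite scale1r (wd_cons None) (wd_cons (Some _)) zE -mulrA mulrDl mulrDr.
    by apply: Plin; apply: IH; [apply: wdA1_x|apply: wdA1_y].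
  - by rewrite -mulrA -wd_cons; apply/IH/wdA1_y.
  - by rewrite mulrDl -scalerAl; apply: Plin; auto.
by move/(_ [::] isT); rewrite wd_nil mulr1.
Qed.

(** * Algebra morphisms given on letters, and the maps phi and psi_s *)

Section Morphism.
Variable g : letter -> B.
Definition wmorph := linext (fun w => \prod_(l <- w) g l).

Lemma wmorphM p q : wmorph (p * q) = wmorph p * wmorph q.
Proof.
elim/wd_ind: p => [v|c p p' IHp IHp'].
  elim/wd_ind: q => [w|c q q' IHq IHq'].
    by rewrite -wd_cat /wmorph !linext_wd big_cat.
  by rewrite mulrDr scaleAr /wmorph !linextP -/wmorph IHq IHq' mulrDr scaleAr.
by rewrite mulrDl -scalerAl /wmorph !linextP -/wmorph IHp IHp' mulrDl -scalerAl.
Qed.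

Lemma wmorph1 : wmorph 1 = 1.
Proof. by rewrite -wd_nil /wmorph linext_wd big_nil wd_nil. Qed.

Lemma wmorph_letter l : wmorph (wd [:: l]) = g l.
Proof. by rewrite /wmorph linext_wd big_seq1. Qed.

Lemma wmorphP c p q : wmorph (c *: p + q) = c *: wmorph p + wmorph q.
Proof. exact: linextP. Qed.

Lemma wmorphD p q : wmorph (p + q) = wmorph p + wmorph q.
Proof. exact: linextD. Qed.

Lemma wmorph_scale c p : wmorph (c *: p) = c *: wmorph p.
Proof. by rewrite -[c *: p]addr0 wmorphP /wmorph linext0 addr0. Qed.
End Morphism.

Definition rhoL s (l : letter) : B := if l is Some _ then z - zd s else zd s.
Definition rho s := wmorph (rhoL s).

Lemma rho_mulz s p : rho s (p * z) = rho s p * z.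
Proof.
have E : rho s z = z by rewrite {1}zE /rho wmorphD !wmorph_letter /= addrC subrK.
by rewrite -[in RHS]E /rho wmorphM.
Qed.

Lemma rho_muly s p : rho s (p * y) = rho s p * (z - zd s).
Proof. by rewrite /rho wmorphM wmorph_letter. Qed.

Definition gphiL (l : letter) : B :=
  if l is Some s then (if delta s then Y s else 0) - y else z.
Definition gphi := wmorph gphiL.
Definition gpsi s p :=
  gphi (linext (fun w => wd (Iw m1 w)) (linext (fun w => wd (Mw s w)) p)).

Lemma gphi_z : gphi z = z - y.
Proof.
by rewrite {1}zE /gphi wmorphD !wmorph_letter /= delta_neq_mu1 eqxx sub0r.
Qed.

Lemma gphi_y : gphi y = (-1) *: y.
Proof. by rewrite /gphi wmorph_letter /= delta_neq_mu1 eqxx sub0r scaleN1r. Qed.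

Lemma gphiM p q : gphi (p * q) = gphi p * gphi q.
Proof. exact: wmorphM. Qed.

Lemma A1_gphi p : A1 p -> A1 (gphi p).
Proof.
elim=> [|{}p _ IH|{}p _ IH|c {}p q _ IHp _ IHq].
- by rewrite /gphi wmorph1; constructor.
- by rewrite gphiM gphi_z mulrBr; apply: A1_sub; constructor.
- by rewrite gphiM gphi_y scaleAr; apply: A1_scale; constructor.
- by rewrite /gphi wmorphP; apply: A1_lin.
Qed.

Definition gsub s := wmorph (fun l => wd [:: ysub s l]).

Lemma gsub_A1 s p : A1 p ->
  linext (fun w => wd (Iw m1 w)) (linext (fun w => wd (Mw s w)) p) = gsub s p.
Proof.
elim/A1_wd_ind => [w Aw|c {}p q IHp IHq]; last by rewrite !linextP IHp IHq /gsub wmorphP.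
rewrite !linext_wd Iw_Mw_A1 // /gsub /wmorph linext_wd.
elim: (w) => [|l v IH] /=; first by rewrite wd_nil big_nil.
by rewrite wd_cons IH big_cons.
Qed.

(** On [A1] all maps involved are multiplicative, so it suffices to follow the generators: z to x to
    x to z, and y to -y to -y_s to y - delta(s) y_s = z - zeta_s. *)
Lemma gpsi_gphi s p : A1 p -> gpsi s (gphi p) = rho s p.
Proof.
move=> Ap; rewrite /gpsi gsub_A1; last exact: A1_gphi.
elim: Ap => [|{}p _ IH|{}p _ IH|c {}p q _ IHp _ IHq].
- by rewrite /gphi /gsub /rho !wmorph1.
- have E : gphi (gsub s (gphi z)) = z.
    rewrite gphi_z zE addrK /gsub wmorph_letter /= /gphi wmorph_letter /=.
    by rewrite zE.
  by rewrite rho_mulz -IH -[in RHS]E /gphi /gsub !wmorphM.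
- have E : gphi (gsub s (gphi y)) = z - zd s.
    rewrite gphi_y /gsub wmorph_scale wmorph_letter /= /gphi wmorph_scale wmorph_letter /=.
    by rewrite scaleN1r opprB subz_zd.
  by rewrite rho_muly -IH -E /gphi /gsub !wmorphM.
- by rewrite /gphi /gsub /rho !wmorphP -/gphi -/(gsub s) IHp IHq.
Qed.

Lemma X_mulI p q : X * p = X * q -> p = q.
Proof.
(* Deleting the first letter is a left inverse of left multiplication by x. *)
have K u : linext (fun w => wd (behead w)) (X * u) = u.
  elim/wd_ind: u => [w|c u u' IHu IHu'].
    by rewrite -wd_cons linext_wd.
  by rewrite mulrDr scaleAr linextP IHu IHu'.
by move=> E; rewrite -(K p) E K.
Qed.

Definition gRinv (c : rat) := linext (fun w => match rev w with
     | Some t :: rk => if t == m1 then c *: wd (rev rk) else 0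
     | _ => 0
     end).

(** In p (y - delta(s) y_s) the words ending in y_1 are exactly those of p y; words ending in
    another y_s are sent to 0. *)
Lemma gRinvK s p : gRinv 1 (p * (z - zd s)) = p.
Proof.
rewrite /gRinv subz_zd; elim/wd_ind: p => [w|c p q IHp IHq].
  rewrite mulrBr linextB /= -wd_rcons linext_wd rev_rcons eqxx scale1r revK.
  case: ifP => ds; rewrite ?mulr0 ?linext0 ?subr0 //.
  rewrite -wd_rcons linext_wd rev_rcons.
  by move: ds; rewrite delta_neq_mu1 => /negPf->; rewrite subr0.
by rewrite mulrDl -scalerAl linextP /= IHp IHq.
Qed.

(** * The diamond product derived from its rules on words *)

Section DiamondOfWords.
Variable dw : mu r -> seq letter -> seq letter -> B.
Hypothesis dw0 : forall s w, dw s [::] w = wd w.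
Hypothesis dwv0 : forall s v, v != [::] -> dw s v [::] = gpsi s (gphi (wd v)).
Hypothesis dwxx : forall s v w, dw s (rcons v None) (rcons w None) =
  dw s v (rcons w None) * X - dw s (rcons v (Some m1)) w * X.
Hypothesis dwyx : forall s v w, dw s (rcons v (Some m1)) (rcons w None) =
  dw s v (rcons w None) * y + dw s (rcons v (Some m1)) w * X.
Hypothesis dwxy : forall s v w, dw s (rcons v None) (rcons w (Some m1)) =
  dw s v (rcons w (Some m1)) * X + dw s (rcons v None) w * y.
Hypothesis dwyy : forall s v w, dw s (rcons v (Some m1)) (rcons w (Some m1)) =
  dw s v (rcons w (Some m1)) * y - dw s (rcons v None) w * y.
Hypothesis dwxt : forall s v w t, t != m1 -> dw s (rcons v None) (rcons w (Some t)) =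
  dw s v (rcons w (Some t)) * X
  + (dw s v (rcons w None) + dw s v (rcons w (Some t))) * Y t
  - dw s (rcons v (Some m1)) w * Y t.
Hypothesis dwyt : forall s v w t, t != m1 -> dw s (rcons v (Some m1)) (rcons w (Some t)) =
  dw s v (rcons w (Some t)) * y
  - (dw s v (rcons w None) + dw s v (rcons w (Some t))) * Y t
  + dw s (rcons v (Some m1)) w * Y t.

Definition gdia s F p := linext (fun u => linext (dw s u) p) F.

Lemma gdiaPl s c p q (w : B) : gdia s (c *: p + q) w = c *: gdia s p w + gdia s q w.
Proof. exact: linextP. Qed.

Lemma gdiaPr s (v : B) c p q : gdia s v (c *: p + q) = c *: gdia s v p + gdia s v q.
Proof.
elim/wd_ind: v => [v|a v v' IHv IHv']; first by rewrite /gdia !linext_wd linextP.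
by rewrite !gdiaPl IHv IHv' !scalerDr !scalerA mulrC addrACA.
Qed.

Lemma gdia_wd s v w : gdia s (wd v) (wd w) = dw s v w.
Proof. by rewrite /gdia !linext_wd. Qed.

Lemma gdiaDr s (v : B) p q : gdia s v (p + q) = gdia s v p + gdia s v q.
Proof. by rewrite -[p in LHS]scale1r gdiaPr scale1r. Qed.

Lemma gdiaDl s (v : B) p q : gdia s (p + q) v = gdia s p v + gdia s q v.
Proof. exact: linextD. Qed.

Lemma gdiaBl s (v : B) p q : gdia s (p - q) v = gdia s p v - gdia s q v.
Proof. exact: linextB. Qed.

Lemma gdia1w s (w : B) : gdia s 1 w = w.
Proof.
elim/wd_ind: w => [w|c p q IHp IHq]; first by rewrite -wd_nil gdia_wd dw0.
by rewrite gdiaPr IHp IHq.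
Qed.

Lemma gdiav1 s (v : B) : A1 v -> gdia s v 1 = rho s v.
Proof.
elim/A1_wd_ind => [w Aw|c p q IHp IHq]; last by rewrite gdiaPl IHp IHq /rho wmorphP.
rewrite -[in LHS]wd_nil gdia_wd; have [->|nw] := eqVneq w [::].
  by rewrite dw0 wd_nil /rho wmorph1.
by rewrite dwv0 // gpsi_gphi //; apply: A1_wd.
Qed.

Lemma gdia_suml s (I : Type) (ks : seq I) (c : I -> rat) (F : I -> B) a (w : B) :
  a * gdia s (\sum_(k <- ks) c k *: F k) w =
  \sum_(k <- ks) c k *: (a * gdia s (F k) w).
Proof.
elim: ks => [|k ks IH]; first by rewrite !big_nil /gdia linext0 mulr0.
by rewrite !big_cons gdiaPl mulrDr scaleAr IH.
Qed.

(** For nonempty w the rules for v x and v y are added and all other terms cancel; for empty w it is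
    a property of rho_s. *)
Lemma gdia_zl s (v w : B) : A1 v -> gdia s (v * z) w = gdia s v w * z.
Proof.
move=> Av; elim/wd_ind: w => [w|c p q IHp IHq]; last first.
  by rewrite !gdiaPr IHp IHq mulrDl scalerAl.
elim/last_ind: w => [|w l _].
  by rewrite wd_nil !gdiav1 // ?rho_mulz //; constructor.
elim/wd_ind: v {Av} => [v|c p q IHp IHq]; last first.
  by rewrite mulrDl -scalerAl !gdiaPl IHp IHq mulrDl scalerAl.
rewrite {1}zE mulrDr gdiaDl -!wd_rcons !gdia_wd zE mulrDr.
case: l => [t|]; last by rewrite dwxx dwyx addrACA addNr addr0.
have [->|nt] := eqVneq t m1; first by rewrite dwxy dwyy addrACA subrr addr0.
rewrite dwxt // dwyt //.
by rewrite addrACA addNr addr0 addrACA subrr addr0.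
Qed.

(** For t = 1 this is the rule for v y and w x; otherwise it is the sum of the rules for w x and w
    y_t. *)
Lemma gdia_yd s (v w : B) t :
  gdia s (v * y) (w * zd t) =
  gdia s v (w * zd t) * (z - zd t) + gdia s (v * y) w * zd t.
Proof.
elim/wd_ind: w => [w|c p q IHp IHq]; last first.
  rewrite mulrDl -scalerAl !gdiaPr IHp IHq !mulrDl -!scalerAl.
  by rewrite scalerDr addrACA.
elim/wd_ind: v => [v|c p q IHp IHq]; last first.
  rewrite mulrDl -scalerAl !gdiaPl IHp IHq !mulrDl -!scalerAl.
  by rewrite scalerDr addrACA.
have [->|nt] := eqVneq t m1.
  by rewrite subz_mu1 zd_mu1 -!wd_rcons !gdia_wd dwyx.
rewrite subz_zd delta_neq_mu1 nt zd_neq_mu1 // mulrDr -!wd_rcons.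
rewrite !gdiaDr !gdia_wd dwyx dwyt //.
rewrite addrACA addrA; set S := (_ + _) * Y t.
by rewrite [in RHS]mulrBr -/S [(_ + _) * y]mulrDl [in RHS]mulrDr !addrA.
Qed.

Lemma gdia_zr s (v w : B) : A1 v -> gdia s v (w * z) = gdia s v w * z.
Proof.
move=> Av; elim: Av w => [|{}v Av IHv|{}v Av IHv|c p q Ap IHp Aq IHq] w.
- by rewrite !gdia1w.
- by rewrite !gdia_zl // IHv.
- have := IHv w; rewrite {1}zE -zd_mu1 mulrDr gdiaDr => IHw.
  rewrite {1}zE mulrDr gdiaDr -zd_mu1 gdia_yd subz_mu1.
  (* The rule for v y and w y, with v x rewritten as v z - v y and z pulled out by [gdia_zl]. *)
  have yyE : gdia s (v * y) (w * y) =
      gdia s v (w * y) * y - (gdia s v w * z - gdia s (v * y) w) * y.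
    rewrite -gdia_zl // -gdiaBl -mulrBr zE addrK.
    elim/wd_ind: w {IHw} => [w|c p q IHp IHq]; last first.
      rewrite mulrDl -scalerAl !gdiaPr IHp IHq !mulrDl -!scalerAl.
      by rewrite scalerBr addrACA -opprD.
    elim/wd_ind: (v) => [u|c p q IHp IHq]; last first.
      rewrite !mulrDl -!scalerAl !gdiaPl IHp IHq !mulrDl -!scalerAl.
      by rewrite scalerBr addrACA -opprD.
    by rewrite -!wd_rcons !gdia_wd dwyy.
  rewrite yyE -IHw -mulrBl; set a := gdia s v (w * zd m1); set b := gdia s v (w * y).
  rewrite opprB addrCA opprD [- a - b]addrC addNKr mulrBl [a * y + _]addrC.
  by rewrite addrACA subrr addr0 -mulrDr zd_mu1 -zE.
- by rewrite !gdiaPl IHp IHq mulrDl scalerAl.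
Qed.

Lemma linext_mul_letter l F (I : Type) (cs : seq I) (G : I -> seq letter -> B) (h : I -> B) :
  (forall w, F (rcons w l) = \sum_(i <- cs) G i w * h i) ->
  forall p, linext F (p * wd [:: l]) = \sum_(i <- cs) linext (G i) p * h i.
Proof.
move=> FG p; elim/wd_ind: p => [w|c p q IHp IHq].
  by rewrite -wd_rcons linext_wd FG; apply: eq_bigr => i _; rewrite linext_wd.
rewrite mulrDl -scalerAl linextP IHp IHq scaler_sumr -big_split.
by apply: eq_bigr => i _ /=; rewrite linextP mulrDl scalerAl.
Qed.

(** * Tree maps on the generators z and zeta_s *)

Section TreeMapsOnGenerators.
Variables (TM : pforest -> B -> B) (gzd : pforest -> mu r -> B).
Let gz f := if pnilp f then z else 0.
Definition gL f (l : letter) :=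
  match l with
  | None => gzd f m1
  | Some s => if s == m1 then gz f - gzd f m1 else gzd f s - gzd f m1
  end.
Hypothesis TMP : forall f c p q, TM f (c *: p + q) = c *: TM f p + TM f q.
Hypothesis TM_letter : forall f p l,
  TM f (p * wd [:: l]) = \sum_(c <- pcop f) TM c.1 p * gL c.2 l.

Lemma TM_add f p q : TM f (p + q) = TM f p + TM f q.
Proof. by rewrite -[p in LHS]scale1r TMP scale1r. Qed.

(** The values on x and y_1 add up to the value on z, which is 0 for a nonempty forest, so only the
    counit term survives. *)
Lemma TM_mulz f p : TM f (p * z) = TM f p * z.
Proof.
rewrite zE mulrDr TM_add !TM_letter -big_split -zE.
rewrite -[RHS](sum_pcop_counitr f (fun a => TM a p * z)); apply: eq_bigr => c _ /=.
rewrite eqxx -mulrDr addrC subrK /gz.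
by case: ifP; rewrite ?mulr0.
Qed.

Lemma TM_mulzd f p t : TM f (p * zd t) = \sum_(c <- pcop f) TM c.1 p * gzd c.2 t.
Proof.
have [->|nt] := eqVneq t m1; first by rewrite zd_mu1 TM_letter.
rewrite zd_neq_mu1 // mulrDr TM_add !TM_letter -big_split.
by apply: eq_bigr => c _ /=; rewrite (negPf nt) -mulrDr addrC subrK.
Qed.

Variable FF : pforest -> B.
Hypothesis FF_nil : FF PNil = 1.
Hypothesis FF_dot : FF (bplus PNil) = y.
Hypothesis FF_bplus : forall us G, ~~ pnilp us -> FF us = G * y ->
  FF (bplus us) = G * (zd m1 + y *+ 2) * y.
Hypothesis FF_cons : forall us ts, ~~ pnilp ts ->
  FF (PCons us ts) = gdia m1 (FF (bplus us)) (FF ts).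
Hypothesis TM1 : forall f, TM f 1 = if pnilp f then 1 else 0.
Hypothesis gzd_nil : forall s, gzd PNil s = zd s.
Hypothesis gzd_dot : forall s, gzd (bplus PNil) s = zd s * (z - zd s).
Hypothesis gzd_bplus : forall us s, ~~ pnilp us ->
  gzd (bplus us) s = gRinv 1 (TM us (zd s)) * (z *+ 2 - zd s) * (z - zd s).
Hypothesis gzd_cons : forall us ts s, ~~ pnilp ts ->
  gzd (PCons us ts) s = TM (bplus us) (TM ts (zd s)).

Let rhoP s := wmorphP (rhoL s).
Let rho1 s := wmorph1 (rhoL s).
Let gdia_yd' s (v w : B) t (_ : A1 v) := gdia_yd s v w t.

Lemma gdia_mu1_1 p : A1 p -> gdia m1 p 1 = p.
Proof.
by move=> Ap; rewrite gdiav1 //; apply: (rho_id subz_mu1 rhoP rho1 rho_mulz rho_muly).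
Qed.

Lemma gFF_mul_y f : ~~ pnilp f -> exists2 G, A1 G & FF f = G * y.
Proof.
exact: (FF_mul_y subz_mu1 gdiaPl gdiaPr gdia1w gdiav1 gdia_zl gdia_zr gdia_yd'
          rhoP rho1 rho_mulz rho_muly FF_dot FF_bplus FF_cons).
Qed.

Lemma TM_gdia f s (w : B) : TM f (zd s * w) = zd s * gdia s (FF f) w.
Proof.
exact: (TM_FF scaleAr subz_mu1 gen_ind gdiaPl gdiaPr gdia1w gdiav1 gdia_zl gdia_zr
          gdia_yd' rhoP rho1 rho_mulz rho_muly (Rinv := fun _ => gRinv 1)
          (fun _ => linextP _) gRinvK
          FF_nil FF_dot FF_bplus FF_cons TMP TM1 TM_mulz TM_mulzd
          gzd_nil gzd_dot gzd_bplus gzd_cons).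
Qed.

End TreeMapsOnGenerators.
End DiamondOfWords.
End Words.

(** * The free algebra on the letters *)

Section WordAlgebra.
Variable r : nat.
Local Notation A := (A r).
Local Notation letter := (letter r).
Implicit Types (p q : A) (v w : seq letter) (s t : mu r).

(** * Linear extension and the basis of words *)

Lemma linextE (F : seq letter -> A) p (d : {fset {fmonom letter}}) :
  (msupp p `<=` d)%fset ->
  linext F p = \sum_(k <- d) p@_k *: F (fmonom_val k).
Proof.
move=> le_pd; rewrite /linext (big_fset_incl _ le_pd) // => k _ /mcoeff_outdom ->.
by rewrite scale0r.
Qed.

Lemma linext_lin (F : seq letter -> A) (c : rat) p q :
  linext F (c *: p + q) = c *: linext F p + linext F q.
Proof.
set d := (msupp p `|` msupp q)%fset.
rewrite (@linextE F p d) ?fsubsetUl // (@linextE F q d) ?fsubsetUr //.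
rewrite (@linextE F (c *: p + q) d); last first.
  by apply: fsubset_trans (msuppD_le _ _) _; rewrite fsetSU // msuppZ_le.
rewrite scaler_sumr -big_split; apply: eq_bigr => k _ /=.
by rewrite mcoeffD mcoeffZ scalerDl scalerA.
Qed.

Lemma linext_word (F : seq letter -> A) w : linext F (wd w) = F w.
Proof. by rewrite /linext /wd msuppU1 big_seq_fset1 mcoeffUU scale1r. Qed.

Lemma sum_wdE p : p = \sum_(k <- msupp p) p@_k *: wd (fmonom_val k).
Proof.
rewrite {1}[p]monalgE; apply: eq_bigr => k _; apply/malgP => k'.
by rewrite mcoeffZ !mcoeffU fmK mulrnAr mulr1.
Qed.

Lemma wd_nil1 : wd [::] = 1 :> A.
Proof. by apply/malgP => k; rewrite mcoeffU1 mcoeff1 -fmoneE eq_sym. Qed.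

Lemma wd_catM v w : wd (v ++ w) = wd v * wd w.
Proof. by rewrite /wd malgM_def fgmulUU mulr1; congr (<< _ >>); rewrite [RHS]fmmulE. Qed.

Lemma malg_scalerAr (c : rat) p q : p * (c *: q) = c *: (p * q).
Proof.
rewrite (malgMEw (fsubset_refl _) (msuppZ_le c q)) malgME scaler_sumr.
apply: eq_bigr => k1 _; rewrite scaler_sumr; apply: eq_bigr => k2 _.
apply/malgP => k; rewrite mcoeffZ !mcoeffU mcoeffZ.
by rewrite mcoeffU mulrnAr mulrCA.
Qed.

Lemma malg_wd_ind (P : A -> Prop) :
  (forall w, P (wd w)) ->
  (forall (c : rat) p q, P p -> P q -> P (c *: p + q)) ->
  forall p, P p.
Proof.
move=> Pw Plin p; rewrite (sum_wdE p).
have P0 : P 0 by rewrite -[0](addNr (wd [::])) -scaleN1r; apply: Plin.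
by elim: (enum_fset _) => [|k ks IH]; rewrite ?big_nil ?big_cons //; apply: Plin.
Qed.

(** Each recursive call of [diaw] removes exactly one letter in total, so this fuel stays exact
    along the recursion. *)
Definition dw s v w := diaw s (size v + size w).+1 (rev v) (rev w).

Lemma dw_rconsE s v w a b : dw s (rcons v a) (rcons w b) =
  diaw s (size v + size w).+3 (a :: rev v) (b :: rev w).
Proof. by rewrite /dw !rev_rcons !size_rcons addSn addnS. Qed.

Lemma dw_rconsl s v w a : diaw s (size v + size w).+2 (a :: rev v) (rev w) = dw s (rcons v a) w.
Proof. by rewrite /dw rev_rcons size_rcons addSn. Qed.

Lemma dw_rconsr s v w b : diaw s (size v + size w).+2 (rev v) (b :: rev w) = dw s v (rcons w b).
Proof. by rewrite /dw rev_rcons size_rcons addnS. Qed.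

Lemma dw_nil s w : dw s [::] w = wd w.
Proof. by rewrite /dw /= revK. Qed.

Lemma dw_nilr s v : v != [::] -> dw s v [::] = psi s (phi (wd v)).
Proof.
rewrite /dw; case/lastP: v => // v a _; rewrite rev_rcons /=.
by rewrite rev_cons revK.
Qed.

Lemma dw_xx s v w : dw s (rcons v None) (rcons w None) =
  dw s v (rcons w None) * lx r - dw s (rcons v (Some (mu1 r))) w * lx r.
Proof. by rewrite dw_rconsE -dw_rconsl -dw_rconsr. Qed.

Lemma dw_yx s v w : dw s (rcons v (Some (mu1 r))) (rcons w None) =
  dw s v (rcons w None) * y1 r + dw s (rcons v (Some (mu1 r))) w * lx r.
Proof. by rewrite dw_rconsE -dw_rconsl -dw_rconsr /= eqxx. Qed.

Lemma dw_xy s v w : dw s (rcons v None) (rcons w (Some (mu1 r))) =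
  dw s v (rcons w (Some (mu1 r))) * lx r + dw s (rcons v None) w * y1 r.
Proof. by rewrite dw_rconsE -dw_rconsl -dw_rconsr /= eqxx. Qed.

Lemma dw_yy s v w : dw s (rcons v (Some (mu1 r))) (rcons w (Some (mu1 r))) =
  dw s v (rcons w (Some (mu1 r))) * y1 r - dw s (rcons v None) w * y1 r.
Proof. by rewrite dw_rconsE -dw_rconsl -dw_rconsr /= !eqxx. Qed.

Lemma dw_xt s v w t : t != mu1 r -> dw s (rcons v None) (rcons w (Some t)) =
  dw s v (rcons w (Some t)) * lx r
  + (dw s v (rcons w None) + dw s v (rcons w (Some t))) * ly t
  - dw s (rcons v (Some (mu1 r))) w * ly t.
Proof.
by move=> /negPf nt; rewrite dw_rconsE -dw_rconsl -!dw_rconsr /= nt.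
Qed.

Lemma dw_yt s v w t : t != mu1 r -> dw s (rcons v (Some (mu1 r))) (rcons w (Some t)) =
  dw s v (rcons w (Some t)) * y1 r
  - (dw s v (rcons w None) + dw s v (rcons w (Some t))) * ly t
  + dw s (rcons v (Some (mu1 r))) w * ly t.
Proof.
by move=> /negPf nt; rewrite dw_rconsE -dw_rconsl -!dw_rconsr /= nt eqxx.
Qed.

Local Notation diaG := (gdia (@linext r) dw).

Lemma diaE s F p : dia s F p = diaG s F p.
Proof.
rewrite /dia /gdia /linext; apply: eq_bigr => u _.
by rewrite scaler_sumr; apply: eq_bigr => v _; rewrite scalerA.
Qed.

(** * The recursion for the tree maps and its fuel *)

Lemma tw_em_cons (tmP : T -> A -> A) l w f :
  tw tmP (l :: w) (mkF (em f)) =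
  \sum_(c <- pcop f) tw tmP w (mkF (em c.1)) * genL tmP (mkF (em c.2)) l.
Proof.
change (\sum_(p <- coprod (mkF (em f))) p.1.1 *: (tw tmP w p.1.2 * genL tmP p.2 l) =
  \sum_(c <- pcop f) tw tmP w (mkF (em c.1)) * genL tmP (mkF (em c.2)) l).
by rewrite coprod_em big_map; apply: eq_bigr => c _; rewrite scale1r.
Qed.

Section Fuel.
Variables (tmP tmQ : T -> A -> A).
(* The recursion for [f~] calls the map of strictly smaller forests only, so the
   fuel of [tm] is irrelevant once it exceeds the number of vertices. *)
Definition agree k := forall g, (psize g < k)%N -> forall p,
  tmP (mkF (em g)) p = tmQ (mkF (em g)) p.

Lemma genzd_agree f s : agree (psize f) ->
  genzd tmP (mkF (em f)) s = genzd tmQ (mkF (em f)) s.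
Proof.
case: f => [|us [|u1 t1]]; first by [].
  case: us => [|u1 t1] ag; first by [].
  have tmE := ag (PCons u1 t1) _ (zd s).
  change (Rinv (z r - zd s) (tmP (mkF (em (PCons u1 t1))) (zd s))
            * (z r *+ 2 - zd s) * (z r - zd s) =
          Rinv (z r - zd s) (tmQ (mkF (em (PCons u1 t1))) (zd s))
            * (z r *+ 2 - zd s) * (z r - zd s)).
  by rewrite tmE //= addn0.
move=> ag; have tmE := ag (PCons u1 t1) _ (zd s).
have tmbE := ag (bplus us) _ (tmQ (mkF (em (PCons u1 t1))) (zd s)).
change (tmP (mkF (em (bplus us))) (tmP (mkF (em (PCons u1 t1))) (zd s)) =
        tmQ (mkF (em (bplus us))) (tmQ (mkF (em (PCons u1 t1))) (zd s))).
rewrite tmE; last by rewrite /= ltnS leq_addl.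
by rewrite tmbE //= addn0 addnS !ltnS leq_addr.
Qed.

Lemma genL_agree f l : agree (psize f) ->
  genL tmP (mkF (em f)) l = genL tmQ (mkF (em f)) l.
Proof.
by move=> ag; case: l => [t|] /=; rewrite !(genzd_agree _ ag).
Qed.

Lemma tw_agree k w f : agree k -> (psize f <= k)%N ->
  tw tmP w (mkF (em f)) = tw tmQ w (mkF (em f)).
Proof.
move=> ag; elim: w f => [|l w IH] f fk; first by [].
rewrite !tw_em_cons; apply: eq_big_all (psize_pcop f) _ => c le.
have le1 : (psize c.1 <= k)%N by apply: leq_trans fk; apply: leq_trans le; apply: leq_addr.
have le2 : (psize c.2 <= k)%N by apply: leq_trans fk; apply: leq_trans le; apply: leq_addl.
congr (_ * _); first exact: IH.
by apply: genL_agree => g gc; apply: ag; apply: leq_trans gc le2.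
Qed.
End Fuel.

Lemma tm_stable n m f p : (psize f < n)%N -> (psize f < m)%N ->
  tm n (mkF (em f)) p = tm (r := r) m (mkF (em f)) p.
Proof.
elim: n m f p => [//|n IH] [//|m] f p; rewrite !ltnS => fn fm.
change (linext (fun w => tw (tm (r := r) n) (rev w) (mkF (em f))) p =
        linext (fun w => tw (tm (r := r) m) (rev w) (mkF (em f))) p).
apply: eq_bigr => k _; congr (_ *: _).
apply: (@tw_agree _ _ (psize f)); last exact: leqnn.
by move=> g gf q; apply: IH; [apply: leq_trans fn|apply: leq_trans fm].
Qed.

Definition tmap f : A -> A := treemap (mkF (em f)).
Definition genzd_em f s : A := genzd (@treemap r) (mkF (em f)) s.

(** [nv] also counts the root added by [mkF], so [treemap] starts with fuel [(psize f).+2] and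
    spends one unit on entry. *)
Lemma tmap_linext f p :
  tmap f p = linext (fun w => tw (tm (psize f).+1) (rev w) (mkF (em f))) p.
Proof. by rewrite /tmap /treemap nv_em. Qed.

(** Rule (IV) with each tensor factor evaluated at its own fuel; [tm_stable] reconciles these with
    the fuel of f. *)
Lemma tmap_letter f p (l : letter) :
  tmap f (p * wd [:: l]) = \sum_(c <- pcop f) tmap c.1 p * gL (z r) genzd_em c.2 l.
Proof.
rewrite tmap_linext.
rewrite (linext_mul_letter (wd := @wd r) linext_lin linext_word wd_catM malg_wd_ind
  (cs := pcop f)
  (G := fun c w => tw (tm (psize c.1).+1) (rev w) (mkF (em c.1)))
  (h := fun c => gL (z r) genzd_em c.2 l)).
  by apply: eq_bigr => c _; rewrite tmap_linext.
move=> w; rewrite rev_rcons tw_em_cons.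
apply: eq_big_all (psize_pcop f) _ => c le.
have le1 : (psize c.1 <= psize f)%N by apply: leq_trans le; apply: leq_addr.
have le2 : (psize c.2 <= psize f)%N by apply: leq_trans le; apply: leq_addl.
apply: (congr2 (fun a b : A => a * b)).
  apply: (@tw_agree _ _ (psize c.1)); last exact: leqnn.
  move=> g gc q; apply: tm_stable; apply: ltnW; last exact: gc.
  exact: leq_trans gc le1.
rewrite (@genL_agree _ (@treemap r)).
  by case: l => [t|]; last by []; rewrite /genL /gL /genz; case: (c.2).
move=> g gc q; rewrite /treemap nv_em; apply: tm_stable; last exact: ltnW.
by apply: ltnW; apply: leq_trans gc le2.
Qed.


Definition Fpoly f : A := Ff r (mkF (em f)).

Let zE : z r = wd [:: None] + wd [:: Some (mu1 r)] := erefl.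
Let zdE s : zd s = wd [:: None] + (if delta s then wd [:: Some s] else 0) := erefl.
Local Notation A1 := (A1 (z r) (wd [:: Some (mu1 r)])).
Local Notation gRinv := (gRinv (@wd r) (@linext r) 1).

Lemma Rinv_gRinv s p : Rinv (z r - zd s) p = gRinv p.
Proof.
(* z - zeta_s = y_1 - delta(s) y_s, so the coefficient by which [Rinv] divides is 1. *)
have c1 : (z r - zd s)@_(FMonom [:: Some (mu1 r)]) = 1.
  rewrite (subz_zd zE zdE s) mcoeffB mcoeffU1 eqxx.
  case: ifP => ds; last by rewrite mcoeff0 subr0.
  rewrite mcoeffU1; case: eqP => [[s1]|_]; last by rewrite subr0.
  by move: ds; rewrite s1 delta_neq_mu1 eqxx.
apply: eq_bigr => k _; rewrite c1 invr1 mulr1.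
case: (rev _) => [|[t|] rk]; last 1 first; try by rewrite scaler0.
by case: (t == mu1 r); rewrite ?scaler0 // scale1r.
Qed.

Lemma Fpoly_bplus us G : ~~ pnilp us -> Fpoly us = G * wd [:: Some (mu1 r)] ->
  Fpoly (bplus us) = G * (zd (mu1 r) + wd [:: Some (mu1 r)] *+ 2) * wd [:: Some (mu1 r)].
Proof.
case: us => [nus|u1 t1 _ FG]; first by case/negP: nus.
(* Since z - zeta_1 = y, this is R_y^{-1} applied to G y. *)
have RK : Rinv (z r - zd (mu1 r)) (G * (z r - zd (mu1 r))) = G.
  rewrite Rinv_gRinv.
  exact: (gRinvK linext_lin linext_word wd_catM malg_wd_ind zE zdE).
rewrite (subz_mu1 zE zdE) in RK.
change (Rinv (wd [:: Some (mu1 r)]) (Fpoly (PCons u1 t1))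
    * (wd [:: None] + wd [:: Some (mu1 r)] *+ 2) * wd [:: Some (mu1 r)] =
  G * (zd (mu1 r) + wd [:: Some (mu1 r)] *+ 2) * wd [:: Some (mu1 r)]).
by rewrite FG RK (zd_mu1 zdE).
Qed.

Lemma Fpoly_cons us ts : ~~ pnilp ts ->
  Fpoly (PCons us ts) = diaG (mu1 r) (Fpoly (bplus us)) (Fpoly ts).
Proof. by case: ts => [nts|u1 t1 _]; [case/negP: nts|rewrite -diaE]. Qed.

Lemma tmap_lin f (c : rat) p q : tmap f (c *: p + q) = c *: tmap f p + tmap f q.
Proof. by rewrite !tmap_linext linext_lin. Qed.

Lemma tmap_one f : tmap f 1 = if pnilp f then 1 else 0.
Proof. by rewrite tmap_linext -[X in linext _ X]wd_nil1 linext_word; case: f. Qed.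

Lemma genzd_bplus us s : ~~ pnilp us ->
  genzd_em (bplus us) s = gRinv (tmap us (zd s)) * (z r *+ 2 - zd s) * (z r - zd s).
Proof. by case: us => [nus|u1 t1 _]; [case/negP: nus|rewrite -(Rinv_gRinv s)]. Qed.

Lemma genzd_cons us ts s : ~~ pnilp ts ->
  genzd_em (PCons us ts) s = tmap (bplus us) (tmap ts (zd s)).
Proof. by case: ts => [nts|u1 t1 _]; first by case/negP: nts. Qed.

Lemma tmap_zd_mul f s p : tmap f (zd s * p) = zd s * diaG s (Fpoly f) p.
Proof.
exact: (TM_gdia malg_scalerAr linext_lin linext_word wd_nil1 wd_catM malg_wd_ind
  zE zdE dw_nil dw_nilr dw_xx dw_yx dw_xy dw_yy dw_xt dw_yt tmap_lin tmap_letter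
  (FF := Fpoly) erefl erefl Fpoly_bplus Fpoly_cons tmap_one
  (gzd := genzd_em) (fun _ => erefl) (fun _ => erefl) genzd_bplus genzd_cons).
Qed.

Lemma Fpoly_mul_y f : ~~ pnilp f -> exists2 G, A1 G & Fpoly f = G * wd [:: Some (mu1 r)].
Proof.
exact: (gFF_mul_y malg_scalerAr linext_lin linext_word wd_nil1 wd_catM malg_wd_ind
  zE zdE dw_nil dw_nilr dw_xx dw_yx dw_xy dw_yy dw_xt dw_yt
  (FF := Fpoly) erefl Fpoly_bplus Fpoly_cons).
Qed.

(** * Membership in A_1^1 and passage to [H] *)

Lemma inA11_lin (c : rat) p q : inA11 p -> inA11 q -> inA11 (c *: p + q).
Proof.
move=> Ap Aq k; rewrite mcoeffD mcoeffZ => nz.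
have [p0|/Ap//] := eqVneq (p@_k) 0.
by apply: Aq; move: nz; rewrite p0 mulr0 add0r.
Qed.

Lemma inA11_0 : inA11 (0 : A).
Proof. by move=> k; rewrite mcoeff0 eqxx. Qed.

Lemma inA11_Fpoly f : inA11 (Fpoly f).
Proof.
have [fN|/Fpoly_mul_y[G AG ->]] := boolP (pnilp f).
  case: f fN => // _ k; rewrite -[Fpoly PNil]/1 -wd_nil1 mcoeffU1.
  by have [<-|_] := eqVneq (FMonom [::]) k; rewrite ?eqxx.
elim/(A1_wd_ind wd_nil1 wd_catM zE): AG => [w Aw|c p q IHp IHq]; last first.
  have mulE (u : A) : (c *: p + q) * u = c *: (p * u) + q * u by rewrite mulrDl scalerAl.
  by rewrite mulE; exact: inA11_lin IHp IHq.
rewrite -(wd_rcons wd_catM) => k; rewrite mcoeffU1.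
have [<- _ /=|_] := eqVneq (FMonom _) k; last by rewrite eqxx.
apply/orP; right; rewrite all_rcons last_rcons eqxx andbT.
exact: (wdA1_y Aw).
Qed.

Lemma inA11_A1 p : inA11 p -> A1 p.
Proof.
move=> Ap; rewrite (sum_wdE p) big_seq_cond.
apply: (big_ind A1); [exact: A1_0|exact: A1_add|move=> k /andP[kp _]].
apply/A1_scale/(A1_wd wd_nil1 wd_catM zE); move: kp; rewrite -mcoeff_neq0 => /Ap.
by case/orP => [/eqP->//|/andP[]].
Qed.

Lemma dia_mu1_1 p : inA11 p -> dia (mu1 r) p 1 = p.
Proof.
move=> /inA11_A1 Ap; rewrite diaE.
exact: (gdia_mu1_1 malg_scalerAr linext_lin linext_word wd_nil1 wd_catM malg_wd_ind
  zE zdE dw_nil dw_nilr).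
Qed.

Lemma zd_mu1_mulI p q : zd (mu1 r) * p = zd (mu1 r) * q -> p = q.
Proof.
rewrite (zd_mu1 zdE).
exact: (X_mulI malg_scalerAr linext_lin linext_word wd_catM malg_wd_ind).
Qed.

Lemma forest_em (k : forest) : exists f, val k = mkF (em f).
Proof. by have [f kf] := canon_em (val k); exists f; rewrite -kf (eqP (valP k)). Qed.

Lemma inA11_FH (f : H) : inA11 (FH r f).
Proof.
rewrite /FH; elim: (enum_fset _) => [|k ks IH]; first by rewrite big_nil; apply: inA11_0.
rewrite big_cons; apply: inA11_lin => //.
by have [g ->] := forest_em k; apply: inA11_Fpoly.
Qed.

Lemma Hmap_FH (f : H) s p : Hmap f (zd s * p) = zd s * dia s (FH r f) p.
Proof.
rewrite diaE /FH (gdia_suml malg_scalerAr linext_lin); apply: eq_bigr => k _.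
have [g ->] := forest_em k; congr (_ *: _); exact: tmap_zd_mul.
Qed.

End WordAlgebra.

Theorem mainTheorem1 (r : nat) (hr : (0 < r)%N) (f : H) :
  (exists! F : A r,
      inA11 F /\
      forall (s : mu r) (w : A r), Hmap f (zd s * w) = zd s * dia s F w)
  /\ (inA11 (FH r f) /\
      forall (s : mu r) (w : A r), Hmap f (zd s * w) = zd s * dia s (FH r f) w).
Proof.
have AFH : inA11 (FH r f) by exact: inA11_FH.
have FHP := conj AFH (@Hmap_FH r f).
split; last exact: FHP.
exists (FH r f); split; first exact: FHP.
(* Both identities at s = 1, w = 1 express f~(x), and x cancels on the left. *)
move=> F [AF HF]; rewrite -(dia_mu1_1 AFH) -[RHS](dia_mu1_1 AF).
exact: zd_mu1_mulI (etrans (esym (Hmap_FH f _ 1)) (HF _ 1)).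
Qed.
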